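(* Let $R$ be an associative ring with unity in which $2$ is a unit, and let $a,b\in R$ be Drazin invertible elements such that $a^{3}b=ba$ and $b^{3}a=ab$. Then $a+b$ is Drazin invertible and $$(a+b)^{D}=\tfrac{1}{8}\,bb^{D}(3a^{3}+3b^{3}-a-b)aa^{D}+a^{D}(1-bb^{D})+(1-aa^{D})b^{D}.$$
   Context: An element $a$ of an associative ring with unity is Drazin invertible if there is an element $x$ (unique if it exists, denoted $a^{D}$) such that $xax=x$, $ax=xa$, and $a^{k}=a^{k+1}x$ for some nonnegative integer $k$ (equivalently, $xax=x$, $ax=xa$ and $a-a^{2}x$ is nilpotent). Here $\tfrac18$ denotes the inverse of $8=2^{3}$ in $R$. *)

(* Defs.v *)
From mathcomp Require Import all_boot all_algebra.

Set Implicit Arguments.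
Unset Strict Implicit.
Unset Printing Implicit Defensive.

Import GRing.Theory.
Local Open Scope ring_scope.

(* [pzRingType] is the structure of arbitrary associative rings with unity,
   the zero ring included; it carries no inversion operation, so two-sided
   inverses are given by a relation. *)
Definition inverse_of (R : pzRingType) (u v : R) : Prop :=
  u * v = 1 /\ v * u = 1.

Definition is_unit (R : pzRingType) (u : R) : Prop :=
  exists v : R, inverse_of u v.

(* [drazin_inverse a x] reads "x = a^D"; see [drazin_inverse_unique]. *)
Definition drazin_inverse (R : pzRingType) (a x : R) : Prop :=
  [/\ x * a * x = x, a * x = x * a & exists k : nat, a ^+ k = a ^+ k.+1 * x].

Lemma drazin_inverse_unique (R : pzRingType) (a x y : R) :
  drazin_inverse a x -> drazin_inverse a y -> x = y.
Proof.
have idem z m : z * a * z = z -> a * z = z * a ->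
    a ^+ m.+1 * z ^+ m.+1 = a * z.
  move=> zaz az; rewrite -exprMn_comm //; elim: m => [|m IHm] //.
  by rewrite exprS IHm az mulrA zaz.
have grow z k n : a ^+ k = a ^+ k.+1 * z -> (k <= n)%N ->
    a ^+ n = a ^+ n.+1 * z.
  by move=> akz /subnK <-; rewrite -addnS !exprD akz -mulrA -akz.
case=> xax ax [k akx] [yay ay [l aly]].
pose m := (maxn k l).+1.
have amx : a ^+ m = a ^+ m.+1 * x.
  by apply: grow akx _; rewrite leqW ?leq_maxl.
have amy : a ^+ m = a ^+ m.+1 * y.
  by apply: grow aly _; rewrite leqW ?leq_maxr.
have eax : a * x = a * x * (a * y).
  have cxm : a ^+ m * x ^+ m = x ^+ m * a ^+ m by apply/commrX/commr_sym/commrX.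
  rewrite -{1}(idem x (maxn k l)) // -/m cxm amy exprSr -mulrA mulrA -cxm.
  by rewrite idem // mulrA.
have eay : a * y = a * x * (a * y).
  have cx : a ^+ m * x = x * a ^+ m by apply/commr_sym/commrX.
  rewrite -{1}(idem y (maxn k l)) // -/m amx exprS -(mulrA a) cx mulrA.
  by rewrite -mulrA idem.
have e : a * x = a * y by rewrite eax -eay.
by rewrite -xax -mulrA e mulrA -ax e ay yay.
Qed.

(* Main.v *)
Require Import Defs.
From mathcomp Require Import all_boot all_algebra.

Set Implicit Arguments.
Unset Strict Implicit.
Unset Printing Implicit Defensive.

Import GRing.Theory.
Local Open Scope ring_scope.

(** Put e = a a^D and f = b b^D. The relations give a^(3n) b = b a^n, whence e
    commutes with b and f with a, and a b = a^27 b^3. Iterating the latter,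
    a b = a^(26m+1) b^(2m+1), so a b and b a are killed by 1 - e and by 1 - f.
    Thus a + b is the orthogonal sum of the nilpotents a(1-e) and b(1-f), of
    a e (1-f) and b f (1-e), whose Drazin inverses are a^D (1-f) and (1-e) b^D,
    and of s = (a+b) e f. In the corner of e f the elements a and b satisfy the
    relations a^4 = 1, a^2 = b^2 of the quaternion group, so z = a^2 is central
    with z^2 = 1, and s^3 = (1 + 3z) s. As (3z-1)(3z+1) = 8, the group inverse
    of s is (3z-1) s / 8. *)

(** * Group inverses and sums of orthogonal elements *)

Lemma drazin_inverse_group (R : pzRingType) (u x : R) :
  x * u * x = x -> u * x = x * u -> u * x * u = u -> drazin_inverse u x.
Proof.
move=> xux ux uxu; split=> //; exists 1%N.
by rewrite expr1 expr2 -mulrA ux mulrA uxu.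
Qed.

(** As [y = v * y * y = y * y * v], and likewise for [x] and [u], every mixed product vanishes along
    with [u * v] and [v * u]. *)
Lemma drazin_inverse_add (R : pzRingType) (u v x y : R) :
  drazin_inverse u x -> drazin_inverse v y -> u * v = 0 -> v * u = 0 ->
  drazin_inverse (u + v) (x + y).
Proof.
move=> [xux ux [k ukx]] [yvy vy [l vly]] uv vu.
have uy : u * y = 0 by rewrite -yvy -vy !mulrA uv !mul0r.
have yu : y * u = 0 by rewrite -yvy -(mulrA y) vy -!mulrA vu !mulr0.
have vx : v * x = 0 by rewrite -xux -ux !mulrA vu !mul0r.
have xv : x * v = 0 by rewrite -xux -(mulrA x) ux -!mulrA uv !mulr0.
have expD n : (u + v) ^+ n.+1 = u ^+ n.+1 + v ^+ n.+1.
  elim: n => [|n IHn] //; rewrite exprS IHn mulrDl !mulrDr -!exprS.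
  by rewrite (exprS v n) (exprS u n) !mulrA uv vu !mul0r addr0 add0r.
have grow (w z : R) i n : w ^+ i = w ^+ i.+1 * z -> (i <= n)%N ->
    w ^+ n = w ^+ n.+1 * z.
  by move=> wz /subnK <-; rewrite -addnS !exprD wz -mulrA -wz.
split.
- rewrite (_ : _ * (u + v) = x * u + y * v).
    rewrite !mulrDl !mulrDr xux yvy -!mulrA.
    by rewrite uy vx !mulr0 addr0 add0r.
  by rewrite !mulrDl !mulrDr xv yu addr0 add0r.
- by rewrite !mulrDl !mulrDr uy vx xv yu ux vy !addr0 !add0r.
(* [expD] covers positive exponents only, whence the extra successor. *)
- exists (maxn k l).+1; rewrite !expD mulrDl !mulrDr.
  rewrite -(grow u x k) ?leqW ?leq_maxl // -(grow v y l) ?leqW ?leq_maxr //.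
  by rewrite (exprSr u _.+1) (exprSr v _.+1) -!mulrA uy vx !mulr0 addr0 add0r.
Qed.

(** * The idempotent [a * x] and commutation with it *)

Section DrazinIdempotent.
Variables (R : pzRingType) (a x : R).
Hypothesis hx : drazin_inverse a x.

Lemma drazin_idem : a * x * (a * x) = a * x.
Proof. by case: hx => xax ax _; rewrite -mulrA (mulrA x) xax. Qed.

Lemma drazin_idem_exp n : a ^+ n.+1 * x ^+ n.+1 = a * x.
Proof.
case: (hx) => xax ax _; rewrite -exprMn_comm //.
by elim: n => [|n IHn] //; rewrite exprS IHn drazin_idem.
Qed.

Lemma drazin_index : exists k, forall n, (k <= n)%N -> a ^+ n * (1 - a * x) = 0.
Proof.
case: hx => _ _ [k akx]; exists k => n /subnK <-.
by rewrite exprD -mulrA mulrBr mulr1 mulrA -exprSr -akx subrr mulr0.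
Qed.

(** With [e = a * x] and [N = m * k.+1], write [e = x ^+ N * a ^+ N] and carry [a ^+ N] across [c]:
    the power left, [a ^+ k.+1], is killed by [1 - e], so [e * c = e * c * e]. Carrying [a ^+ k.+1]
    back across [c] gives [c * e = e * c * e]. *)
Lemma drazin_idem_comm m c :
  (0 < m)%N -> (forall n, a ^+ (m * n) * c = c * a ^+ n) ->
  GRing.comm (a * x) c.
Proof.
case: (hx) => _ ax _ m_gt0 hc; have [k hk] := drazin_index.
have cE n : GRing.comm (a * x) (a ^+ n).
  by apply: commrX; apply: commr_sym; apply: commrM.
have cX n : a ^+ n * x ^+ n = x ^+ n * a ^+ n.
  by apply: commrX; apply: commr_sym; apply: commrX.
have : (0 < m * k.+1)%N by rewrite muln_gt0 m_gt0.
case Dn: (m * k.+1)%N => [|n] // _.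
have eak p : (k <= p)%N -> a * x * a ^+ p = a ^+ p.
  by move/hk; rewrite mulrBr mulr1 => /subr0_eq; rewrite -cE => <-.
have kn : (k <= n.+1)%N by rewrite -Dn (leq_trans (leqnSn k)) ?leq_pmull.
have ec : a * x * c * (1 - a * x) = 0.
  by rewrite -{1}(drazin_idem_exp n) cX -(mulrA _ _ c) -Dn hc -!mulrA hk ?mulr0.
have ce : c * (a * x) = a * x * c * (a * x).
  rewrite -{1 3}(drazin_idem_exp k) !mulrA -(mulrA (a * x) c) -hc Dn.
  by rewrite mulrA eak.
by apply/eqP; rewrite -subr_eq0 ce -{1}(mulr1 (a * x * c)) -mulrBr ec.
Qed.

(** Drazin inverse 0 encodes nilpotency, so [drazin_inverse_add] applies to this summand as well. *)
Lemma drazin_inverse_nilp_part : drazin_inverse (a * (1 - a * x)) 0.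
Proof.
case: (hx) => _ ax _; have [k hk] := drazin_index.
split; rewrite ?mulr0 ?mul0r //; exists k.+1; rewrite mulr0 exprMn_comm.
  by rewrite (exprS (1 - _)) mulrA hk ?leqnSn // mul0r.
by apply: commrB; [apply: commr1 | apply: commrM].
Qed.

(** Since [c] commutes with [a * x], both [x * c] and [c * x] equal [x * a * c * x]. *)
Lemma drazin_double_comm c : GRing.comm a c -> GRing.comm x c.
Proof.
case: (hx) => xax ax _ ac.
have ec : GRing.comm (a * x) c.
  apply: (@drazin_idem_comm 1) => // n; rewrite mul1n.
  by apply: commr_sym; apply: commrX; apply: commr_sym.
rewrite /GRing.comm; transitivity (x * a * c * x).
  by rewrite -mulrA -(mulrA x a) (mulrA a) ac -(mulrA c) -ec !mulrA xax.
by rewrite -ax ec -!mulrA (mulrA a) ax xax.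
Qed.

End DrazinIdempotent.

(** * Consequences of the cube relations *)

Lemma cube_rel_exp (R : pzRingType) (a b : R) (hab : a ^+ 3 * b = b * a) m n :
  a ^+ (3 ^ m * n) * b ^+ m = b ^+ m * a ^+ n.
Proof.
have hn i : a ^+ (3 * i) * b = b * a ^+ i.
  rewrite exprM; elim: i => [|i IHi]; first by rewrite !expr0 mul1r mulr1.
  by rewrite exprS -mulrA IHi mulrA hab -mulrA -exprS.
elim: m => [|m IHm]; first by rewrite mul1n !expr0 mul1r mulr1.
by rewrite expnS -mulnA [b ^+ m.+1]exprS mulrA hn -mulrA IHm mulrA.
Qed.

Section CubeRelations.
Variables (R : pzRingType) (a b : R).
Hypotheses (hab : a ^+ 3 * b = b * a) (hba : b ^+ 3 * a = a * b).

Lemma cube_rels_mul_iter m : a * b = a ^+ (26 * m).+1 * b ^+ (2 * m).+1.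
Proof.
(* In [b ^+ 3 * a], each of the three factors [b] passed cubes [a], and 27 = 3^3. Each use on the
   middle [a * b] then adds 26 and 2 to the exponents. *)
have ab27 : a * b = a ^+ 27 * b ^+ 3.
  by rewrite -hba -[in LHS](expr1 a) -(cube_rel_exp hab 3 1).
elim: m => [|m IHm]; first by rewrite !expr1.
rewrite IHm exprSr exprS mulrA -(mulrA _ a) {}ab27 mulrA -exprD -mulrA -exprD.
by rewrite !mulnS (addnC 26) (addnC 2) !addnS !addn0 -!addSn.
Qed.

Lemma cube_rels_idem_comm x : drazin_inverse a x -> GRing.comm (a * x) b.
Proof.
move=> hx; apply: (drazin_idem_comm (m := 3) hx) => // n.
exact: (cube_rel_exp hab 1).
Qed.

Lemma cube_rels_mul_idemCl x : drazin_inverse a x -> a * b * (1 - a * x) = 0.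
Proof.
move=> hx; have [k hk] := drazin_index hx.
have cb : GRing.comm b (1 - a * x).
  by apply: commrB; [apply: commr1 | apply/commr_sym/cube_rels_idem_comm].
rewrite (cube_rels_mul_iter k) -mulrA -(commrX _ (commr_sym cb)) mulrA.
rewrite hk ?mul0r //.
by rewrite leqW // leq_pmull.
Qed.

Lemma cube_rels_mul_idemCr y : drazin_inverse b y -> a * b * (1 - b * y) = 0.
Proof.
move=> hy; have [k hk] := drazin_index hy.
rewrite (cube_rels_mul_iter k) -mulrA hk ?mulr0 //.
by rewrite leqW // leq_pmull.
Qed.

(** Cancellation alone lowers the exponents: first [a ^+ 26 * b ^+ 2 = 1], then [a ^+ 8 = 1], then
    [a ^+ 4 = 1]. *)
Lemma cube_rels_quaternion :
  GRing.lreg a -> GRing.lreg b -> GRing.rreg b -> a ^+ 4 = 1 /\ a ^+ 2 = b ^+ 2.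
Proof.
move=> la lb rb.
have laX n : GRing.lreg (a ^+ n) by apply: lregX.
have a26b2 : a ^+ 26 * b ^+ 2 = 1.
  apply: la; apply: rb; rewrite mulr1 (cube_rels_mul_iter 1) mulrA -exprS.
  by rewrite -mulrA -exprSr.
have cb2a : b ^+ 2 * a = a * b ^+ 2.
  apply: (laX 26); rewrite [LHS]mulrA a26b2 mul1r mulrA -exprSr (exprS a).
  by rewrite -mulrA a26b2 mulr1.
(* Passing [b ^+ 2] turns [a] into [a ^+ 9], yet [b ^+ 2] commutes with [a]. *)
have a8 : a ^+ 8 = 1.
  apply: la; apply: (rregX (n := 2) rb) => /=.
  have := cube_rel_exp hab 2 1; rewrite expr1 cb2a mulr1 => <-.
  by rewrite -exprS.
have a2b2 : a ^+ 2 * b ^+ 2 = 1.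
  by rewrite -a26b2 -[26%N]/(8 * 3 + 2)%N exprD exprM a8 expr1n mul1r.
(* Insert [a ^+ 2 * b ^+ 2 = 1] after [b] and move [b] across [a ^+ 2]: this yields
   [b = a ^+ 4 * b]. *)
have a4 : a ^+ 4 = 1.
  have h6 : b * a ^+ 2 = a ^+ 4 * a ^+ 2 * b.
    by rewrite -exprD -{1}(expr1 b) -(cube_rel_exp hab 1 2).
  apply: rb; rewrite mul1r -[RHS]mulr1 -a2b2 [RHS]mulrA h6 -[RHS]mulrA -exprS.
  by rewrite (exprSr b) [RHS]mulrA -(mulrA _ (a ^+ 2)) a2b2 mulr1.
by split=> //; apply: (laX 2); rewrite -exprD a2b2.
Qed.

End CubeRelations.

(** * Passage to the corner of an idempotent *)

Section Corner.
Variables (R : pzRingType) (p : R).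
Hypothesis pp : p * p = p.

(* Extends u p, an element of the corner ring p R p, by 1 on the complement:
   units and identities of the corner become units and identities of R. *)
Definition corner (u : R) : R := u * p + (1 - p).

Lemma cornerM u v : GRing.comm p v -> corner u * corner v = corner (u * v).
Proof.
rewrite /corner => pv; set q := 1 - p.
have pq : p * q = 0 by rewrite mulrBr mulr1 pp subrr.
have qp : q * p = 0 by rewrite mulrBl mul1r pp subrr.
have qq : q * q = q by rewrite {1}/q mulrBl mul1r pq subr0.
rewrite mulrDl; move: q pq qp qq => q pq qp qq.
rewrite !mulrDr qq -!mulrA pq mulr0 addr0 -pv (mulrA p) pp.
by rewrite (mulrA q) qp mul0r add0r.
Qed.

Lemma corner1 : corner 1 = 1.
Proof. by rewrite /corner mul1r addrC subrK. Qed.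

Lemma cornerX u n : GRing.comm p u -> corner u ^+ n = corner (u ^+ n).
Proof.
move=> pu; elim: n => [|n IHn]; first by rewrite !expr0 corner1.
by rewrite exprS IHn cornerM -?exprS //; apply: commrX.
Qed.

Lemma corner_inj u v : corner u = corner v -> u * p = v * p.
Proof. by move/addIr. Qed.

End Corner.

Lemma lreg_left_inverse (R : pzRingType) (u v : R) : v * u = 1 -> GRing.lreg u.
Proof. by move=> vu r s /(congr1 ( *%R v)); rewrite !mulrA vu !mul1r. Qed.

Lemma rreg_right_inverse (R : pzRingType) (u v : R) : u * v = 1 -> GRing.rreg u.
Proof. by move=> uv r s /(congr1 ( *%R^~ v)); rewrite -!mulrA uv !mulr1. Qed.

(** The one-sided inverses that [x] and [y] provide on [p] make [corner p a] and [corner p b]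
    cancellable in [R] itself, so the quaternion relations hold for them and restrict to [p]. *)
Lemma corner_quaternion (R : pzRingType) (a b x y p : R) :
  p * p = p -> GRing.comm p a -> GRing.comm p b -> GRing.comm p y ->
  x * a * p = p -> y * b * p = p -> b * y * p = p ->
  a ^+ 3 * b = b * a -> b ^+ 3 * a = a * b ->
  a ^+ 4 * p = p /\ a ^+ 2 * p = b ^+ 2 * p.
Proof.
move=> pp pa pb py xap ybp byp hab hba.
have inv u v : u * v * p = p -> GRing.comm p v -> corner p u * corner p v = 1.
  by move=> uvp pv; rewrite cornerM // /corner uvp addrC subrK.
have := @cube_rels_quaternion R (corner p a) (corner p b).
case.
- by rewrite !(cornerX, cornerM) ?hab.
- by rewrite !(cornerX, cornerM) ?hba.
- exact: lreg_left_inverse (inv _ _ xap pa).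
- exact: lreg_left_inverse (inv _ _ ybp pb).
- exact: rreg_right_inverse (inv _ _ byp py).
rewrite !cornerX // -[in 1](corner1 p) => /corner_inj a4 /corner_inj.
by rewrite a4 mul1r.
Qed.

(** * The group inverse of the corner summand *)

Lemma drazin_inverse_cubic (R : pzRingType) (s z t : R) :
  inverse_of (8%:R : R) t -> GRing.comm z s -> z ^+ 2 * s = s ->
  s ^+ 3 = (1 + 3%:R * z) * s ->
  drazin_inverse s (t * ((3%:R * z - 1) * s)).
Proof.
move=> [t8 _] zs z2s s3; set w := 3%:R * z - 1.
(* [t] is central because 8 is. *)
have tC r : GRing.comm t r.
  have t8' : t * 8%:R = 1 by rewrite (commr_nat t 8).
  rewrite /GRing.comm -[r in LHS]mulr1 -t8 (mulrA r).
  by rewrite (commr_nat r 8) !mulrA t8' mul1r.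
have ws : GRing.comm w s.
  apply: commr_sym; apply: commrB; last exact: commr1.
  by apply: commrM; [apply: commr_nat | apply: commr_sym].
(* On [s], (3z-1)(3z+1) = 9z^2 - 1 acts as 8. *)
have ws3 : w * s ^+ 3 = s * 8%:R.
  rewrite s3 mulrA (_ : w * _ = 9%:R * z ^+ 2 - 1).
    by rewrite mulrBl -mulrA z2s mul1r mulr_natl mulr_natr [in LHS]mulrSr addrK.
  rewrite /w mulrBl mul1r mulrDr mulr1 (addrC (3%:R * z)) (addrC 1) addrKA.
  by rewrite !mulr_natl mulrnAl mulrnAr -mulrnA.
have sy : s * (t * (w * s)) = t * (w * s) * s.
  by rewrite -!mulrA (mulrA s t) -tC -mulrA (mulrA s w) -ws !mulrA.
have sys : t * (w * s) * s * s = s.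
  rewrite -!mulrA -expr2 -exprS ws3 mulrA tC -mulrA.
  by rewrite (commr_nat t 8) t8 mulr1.
apply: drazin_inverse_group.
- move: sys; set g := t * (w * s) * s => sys.
  by rewrite [LHS]mulrA -(tC g) -[LHS]mulrA ws (mulrA g) sys.
- exact: sy.
- by rewrite sy.
Qed.

(** On [p], with [z = a ^+ 2], one has [b * a = z * (a * b)], so the square of [s = (a + b) * p] is
    2z + (1+z)ab. Multiplying by [s] turns [a * b] into [z * a + b], and 1 + z absorbs this [z]
    because z^2 = 1; the total is (2z + 1 + z)s. *)
Lemma quaternion_sum_cube (R : pzRingType) (a b p : R) :
  p * p = p -> GRing.comm p a -> GRing.comm p b -> a ^+ 3 * b = b * a ->
  a ^+ 4 * p = p -> a ^+ 2 * p = b ^+ 2 * p ->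
  [/\ GRing.comm (a ^+ 2) ((a + b) * p),
      (a ^+ 2) ^+ 2 * ((a + b) * p) = (a + b) * p &
      ((a + b) * p) ^+ 3 = (1 + 3%:R * a ^+ 2) * ((a + b) * p)].
Proof.
move=> pp pa pb hab a4 a2b2.
have [z Dz] : exists z, a ^+ 2 = z by exists (a ^+ 2).
rewrite Dz in a2b2 *.
have z2p : z ^+ 2 * p = p by rewrite -Dz -exprM.
have ps : GRing.comm p (a + b) by apply: commrD.
have pz : GRing.comm p z by rewrite -Dz; apply: commrX.
have z2s : z ^+ 2 * ((a + b) * p) = (a + b) * p.
  by rewrite -ps mulrA z2p.
have baz : b * a = z * (a * b) by rewrite -hab exprSr Dz -mulrA.
have za : GRing.comm z a by rewrite -Dz; apply/commr_sym/commrX.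
(* [b * a ^+ 2 = a ^+ 6 * b], and [a ^+ 4] is trivial on [p]. *)
have bzp : b * z * p = z * b * p.
  have -> : b * z = a ^+ 4 * (z * b).
    have := cube_rel_exp hab 1 2; rewrite expr1 Dz => <-.
    by rewrite -Dz mulrA -exprD.
  by rewrite -(mulrA _ _ p) -(commrM pz pb) mulrA a4.
have zs : GRing.comm z ((a + b) * p).
  rewrite /GRing.comm -(mulrA (a + b)) pz [LHS]mulrA [RHS]mulrA mulrDr.
  by rewrite !mulrDl bzp za.
split=> //.
have s2 : (a + b) * (a + b) * p = (2%:R * z + (1 + z) * (a * b)) * p.
  rewrite mulrDl !mulrDr -!expr2 baz Dz mulr_natl mulr2n !mulrDl -a2b2.
  by rewrite mul1r [RHS]addrACA [X in _ + X = _]addrC.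
have abs : a * b * (a + b) * p = (z * a + b) * p.
  have aba : a * b * a * p = b * p.
    by rewrite -(mulrA a) -hab mulrA -exprS -mulrA -pb mulrA a4.
  have abb : a * b * b * p = z * a * p.
    by rewrite -(mulrA a) -expr2 -mulrA -a2b2 mulrA za.
  by rewrite mulrDr !mulrDl aba abb addrC.
have ss : (1 + z) * ((z * a + b) * p) = (1 + z) * ((a + b) * p).
  have zzap : z * (z * (a * p)) = a * p by rewrite -pa !mulrA -expr2 z2p.
  rewrite !(mulrDl _ _ p) -(mulrA z a p) !mulrDl !mul1r !mulrDr zzap.
  by rewrite addrACA [X in X + _ = _]addrC [RHS]addrACA.
have pS : p * ((a + b) * p) = (a + b) * p by rewrite mulrA ps -mulrA pp.
rewrite exprSr expr2 -(mulrA (a + b) p) pS (mulrA (a + b) (a + b)) s2.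
rewrite -[LHS]mulrA pS.
rewrite mulrDl -(mulrA (1 + z)) (mulrA (a * b)) abs ss -mulrDl; congr (_ * _).
by rewrite addrCA -[3%N]/(2 + 1)%N natrD (mulrDl 2%:R) mul1r.
Qed.

(** * Assembling the orthogonal summands *)

Lemma orthogonal_idem (R : pzRingType) (q u v : R) :
  u * q = u -> q * u = u -> q * v = 0 -> v * q = 0 -> u * v = 0 /\ v * u = 0.
Proof.
move=> uq qu qv vq; split; first by rewrite -uq -mulrA qv mulr0.
by rewrite -qu mulrA vq mul0r.
Qed.

(** [x] is the group inverse of the core part [a * (a * x)]; a commuting idempotent [q] cuts both
    down. *)
Lemma drazin_inverse_idem (R : pzRingType) (a x q : R) :
  drazin_inverse a x -> q * q = q -> GRing.comm q a ->
  drazin_inverse (a * (a * x) * q) (x * q).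
Proof.
move=> hx qq qa; have [xax ax _] := hx.
have qx : GRing.comm q x by apply/commr_sym/(drazin_double_comm hx)/commr_sym.
have qe : GRing.comm q (a * x) by apply: commrM.
have mulq u v : GRing.comm q v -> u * q * (v * q) = u * v * q.
  by move=> qv; rewrite -mulrA (mulrA q v) qv -(mulrA v) qq mulrA.
have aexE : a * (a * x) * x = a * x by rewrite -mulrA {1}ax xax.
have eaE : a * x * a = a * (a * x) by rewrite -mulrA ax.
have xaeE : x * (a * (a * x)) = a * x by rewrite mulrA -ax (drazin_idem hx).
have qae : GRing.comm q (a * (a * x)) by apply: commrM.
apply: drazin_inverse_group.
- by rewrite !mulq // xaeE {1}ax xax.
- by rewrite !mulq // xaeE aexE.
- by rewrite !mulq // aexE (mulrA (a * x)) eaE -(mulrA a) (drazin_idem hx).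
Qed.

Theorem theorem3p6 (R : pzRingType) (h2 : is_unit (2%:R : R))
    (eighth : R) (h8 : inverse_of (8%:R : R) eighth)
    (a b aD bD : R)
    (haD : drazin_inverse a aD) (hbD : drazin_inverse b bD)
    (hab : a ^+ 3 * b = b * a) (hba : b ^+ 3 * a = a * b) :
  drazin_inverse (a + b)
    (eighth * (b * bD * (3%:R * a ^+ 3 + 3%:R * b ^+ 3 - a - b) * (a * aD))
     + aD * (1 - b * bD) + (1 - a * aD) * bD).
Proof.
have [_ ax _] := haD; have [_ by_ _] := hbD.
have eb := cube_rels_idem_comm hab haD.
have fa := cube_rels_idem_comm hba hbD.
(* The hypotheses are symmetric in [a] and [b], so each of the two lemmas also applies with the
   roles exchanged. *)
have abe := cube_rels_mul_idemCl hab hba haD.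
have abf := cube_rels_mul_idemCr hab hba hbD.
have bae := cube_rels_mul_idemCr hba hab haD.
have baf := cube_rels_mul_idemCl hba hab hbD.
have ea : GRing.comm (a * aD) a by rewrite /GRing.comm -mulrA ax.
have fb : GRing.comm (b * bD) b by rewrite /GRing.comm -mulrA by_.
have ee := drazin_idem haD; have ff := drazin_idem hbD.
have ey : GRing.comm (a * aD) bD.
  by apply/commr_sym/(drazin_double_comm hbD)/commr_sym.
have fy : GRing.comm (b * bD) bD by rewrite /GRing.comm {1}by_ mulrA.
have ef : GRing.comm (a * aD) (b * bD) by apply: commrM.
have idC (q : R) : q * q = q -> (1 - q) * (1 - q) = 1 - q.
  by move=> qq; rewrite mulrBl mul1r mulrBr mulr1 qq subrr subr0.
have commC (q r : R) : GRing.comm q r -> GRing.comm (1 - q) r.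
  by move=> qr; apply/commr_sym/commrB; [apply: commr1 | apply: commr_sym].
have d4 := drazin_inverse_nilp_part haD.
have d5 := drazin_inverse_nilp_part hbD.
have d2 := drazin_inverse_idem haD (idC _ ff) (commC _ _ fa).
have d3 := drazin_inverse_idem hbD (idC _ ee) (commC _ _ eb).
have [e De] : exists e, a * aD = e by exists (a * aD).
have [f Df] : exists f, b * bD = f by exists (b * bD).
rewrite De Df in eb fa abe abf bae baf ea fb ee ff ey fy ef d2 d3 d4 d5 *.
have eC : e * (1 - e) = 0 by rewrite mulrBr mulr1 ee subrr.
have Ce : (1 - e) * e = 0 by rewrite mulrBl mul1r ee subrr.
have fC : f * (1 - f) = 0 by rewrite mulrBr mulr1 ff subrr.
have Cf : (1 - f) * f = 0 by rewrite mulrBl mul1r ff subrr.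
have [p Dp] : exists p, p = e * f by exists (e * f).
have pp : p * p = p by rewrite Dp -mulrA (mulrA f) -ef -mulrA ff mulrA ee.
have pC r : GRing.comm e r -> GRing.comm f r -> GRing.comm p r.
  by rewrite Dp => er fr; apply/commr_sym/commrM; apply: commr_sym.
have pa : GRing.comm p a by apply: pC.
have pb : GRing.comm p b by apply: pC.
have py : GRing.comm p bD by apply: pC.
have ep : e * p = p by rewrite Dp mulrA ee.
have fp : f * p = p by rewrite Dp ef mulrA ff.
have pe : p * e = p by rewrite Dp -mulrA -ef mulrA ee.
have pf : p * f = p by rewrite Dp -mulrA ff.
have [a4 a2b2] : a ^+ 4 * p = p /\ a ^+ 2 * p = b ^+ 2 * p.
  apply: (corner_quaternion (x := aD) (y := bD)) => //.
  - by rewrite -ax De.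
  - by rewrite -by_ Df.
  - by rewrite Df.
have [zs z2s s3] := quaternion_sum_cube pp pa pb hab a4 a2b2.
have d1 := drazin_inverse_cubic h8 zs z2s s3.
have ps : GRing.comm p (a + b) by apply: commrD.
(* On [p], [b ^+ 3 = a ^+ 2 * b], so the cubic expression of the statement factors as (3a^2 - 1)(a +
   b). *)
have -> : f * (3%:R * a ^+ 3 + 3%:R * b ^+ 3 - a - b) * e
    = (3%:R * a ^+ 2 - 1) * ((a + b) * p).
  have Xp (X : R) : GRing.comm f X -> f * X * e = X * p.
    by move=> fX; rewrite fX -mulrA -ef Dp.
  have b3 : b ^+ 3 * p = a ^+ 2 * b * p.
    by rewrite exprSr -mulrA -pb mulrA -a2b2 -mulrA pb mulrA.
  rewrite Xp; last first.
    by do 2?apply: commrB => //; apply: commrD; apply: commrM;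
      by [apply: commr_nat | apply: commrX].
  rewrite -addrA -opprD mulrBl mulrDl -(mulrA _ _ p) -(mulrA _ (b ^+ 3)) b3.
  by rewrite mulrBl mul1r exprSr -mulrDr -mulrDl -mulrDr !mulrA.
have fae : GRing.comm f (a * e) by apply: commrM.
have ebf : GRing.comm e (b * f) by apply: commrM.
(* The idempotent [f] separates these two summands; [e] then separates their sum from the third. *)
have [o1 o1'] : (a + b) * p * (a * e * (1 - f)) = 0
    /\ a * e * (1 - f) * ((a + b) * p) = 0.
  apply: (@orthogonal_idem _ f).
  - by rewrite -mulrA pf.
  - by rewrite -ps mulrA fp.
  - by rewrite mulrA fae -mulrA fC mulr0.
  - by rewrite -mulrA Cf mulr0.
have d12 := drazin_inverse_add d1 d2 o1 o1'.
have [o2 o2'] : ((a + b) * p + a * e * (1 - f)) * (b * f * (1 - e)) = 0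
    /\ b * f * (1 - e) * ((a + b) * p + a * e * (1 - f)) = 0.
  have eCf : GRing.comm e (1 - f) by apply: commrB => //; apply: commr1.
  have eu : GRing.comm e ((a + b) * p + a * e * (1 - f)).
    apply: commrD; apply: commrM => //; last exact: commrM.
      exact: commrD.
    by rewrite /GRing.comm ep pe.
  have ue : ((a + b) * p + a * e * (1 - f)) * e = (a + b) * p + a * e * (1 - f).
    by rewrite mulrDl -!mulrA pe -eCf (mulrA e) ee.
  apply: (@orthogonal_idem _ e) => //; first by rewrite eu.
  - by rewrite mulrA ebf -mulrA eC mulr0.
  - by rewrite -mulrA Ce mulr0.
have d123 := drazin_inverse_add d12 d3 o2 o2'.
have eW : (a + b) * p + a * e * (1 - f) + b * f * (1 - e) = a * e + b * f.
  rewrite !mulrBr !mulr1 -(mulrA a) -(mulrA b f) -ef -Dp mulrDl.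
  by rewrite -addrA addrACA !subrKC.
rewrite {}eW in d123.
(* The terms in [a] alone vanish by e(1-e) = 0, the mixed ones because [1 - e] kills [a * b] and
   [b * a]; the last summand is treated alike with [f]. *)
have [o3 o3'] : (a * e + b * f) * (a * (1 - e)) = 0
    /\ a * (1 - e) * (a * e + b * f) = 0.
  have eCa : GRing.comm (1 - e) a by apply: commC.
  have eCb : GRing.comm (1 - e) b by apply: commC.
  split.
    rewrite mulrDl -eCa -(mulrA a e) (mulrA e) eC mul0r mulr0 add0r.
    by rewrite -fb -mulrA eCa (mulrA b) bae mulr0.
  rewrite mulrDr -ea -mulrA (mulrA (1 - e)) Ce mul0r mulr0 add0r.
  by rewrite -mulrA (mulrA (1 - e)) eCb !mulrA abe mul0r.
have d1234 := drazin_inverse_add d123 d4 o3 o3'.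
have eW : a * e + b * f + a * (1 - e) = a + b * f.
  by rewrite addrAC -mulrDr subrKC mulr1.
rewrite {}eW in d1234.
have [o4 o4'] : (a + b * f) * (b * (1 - f)) = 0
    /\ b * (1 - f) * (a + b * f) = 0.
  have fCa : GRing.comm (1 - f) a by apply: commC.
  have fCb : GRing.comm (1 - f) b by apply: commC.
  split.
    by rewrite mulrDl mulrA abf add0r -fCb -mulrA (mulrA f) fC mul0r mulr0.
  rewrite mulrDr -(mulrA b _ a) fCa (mulrA b a) baf add0r -fb.
  by rewrite -mulrA (mulrA (1 - f)) Cf mul0r mulr0.
have := drazin_inverse_add d1234 d5 o4 o4'.
(* The two nilpotent summands contribute 0 to the inverse. *)
rewrite !addr0 -addrA -mulrDr subrKC mulr1.
have -> : bD * (1 - e) = (1 - e) * bD by rewrite mulrBr mulrBl mulr1 mul1r ey.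
by [].
Qed.
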